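(* Let $r\geq 2$ and $t\geq 1$ be integers and let $\mathcal{H}_1,\ldots,\mathcal{H}_t$ be finite hypergraphs, none of which has $\emptyset$ as an edge. Then $$\chi\left(\operatorname{KG}^r(\mathcal{H}_1)\times\cdots\times\operatorname{KG}^r(\mathcal{H}_t)\right)\geq\frac{1}{r-1}\min_{\ell=1,\ldots,t}\operatorname{cd}_r(\mathcal{H}_{\ell}).$$
   Context: A hypergraph $\mathcal{H}=(V,E)$ consists of a finite vertex set $V$ and a set $E$ of subsets of $V$ (edges). A proper coloring assigns colors to vertices so that no edge is monochromatic; $\chi(\mathcal{H})$ is the minimum number of colors in a proper coloring. For an integer $r\geq 2$, the Kneser hypergraph $\operatorname{KG}^r(\mathcal{H})$ has vertex set $E(\mathcal{H})$ and edge set $\{\{e_1,\ldots,e_r\}: e_1,\ldots,e_r\in E(\mathcal{H}),\ e_i\cap e_j=\emptyset \text{ for all } i\neq j\}$. The categorical product $\mathcal{G}_1\times\cdots\times\mathcal{G}_t$ of hypergraphs $\mathcal{G}_\ell=(V_\ell,E_\ell)$ has vertex set $V_1\times\cdots\times V_t$, and a subset $F\subseteq V_1\times\cdots\times V_t$ is an edge iff for every $\ell$ the projection of $F$ onto the $\ell$-th coordinate is an edge of $\mathcal{G}_\ell$. For $X\subseteq V(\mathcal{H})$, the induced subhypergraph $\mathcal{H}[X]$ has vertex set $X$ and edge set $\{e\in E(\mathcal{H}): e\subseteq X\}$. The $r$-colorability defect is $\operatorname{cd}_r(\mathcal{H})=\min\{|Y|: Y\subseteq V(\mathcal{H}),\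 \chi(\mathcal{H}[V(\mathcal{H})\setminus Y])\leq r\}$. *)

(* Defs.v *)
From HB Require Import structures.
From mathcomp Require Import all_boot all_order all_algebra.
From mathcomp Require Import boolp constructive_ereal.

Set Implicit Arguments.
Unset Strict Implicit.
Unset Printing Implicit Defensive.

Import Order.TTheory GRing.Theory Num.Theory.

Record hypergraph := Hypergraph {
  vertex : finType;
  edges : {set {set vertex}} }.

Section Coloring.
Variable H : hypergraph.

Definition monochromatic (C : eqType) (c : vertex H -> C) (e : {set vertex H}) :=
  [forall x in e, forall y in e, c x == c y].

Definition proper_coloring (C : eqType) (c : vertex H -> C) :=
  [forall e in edges H, ~~ monochromatic c e].

Definition colorable (k : nat) :=
  [exists c : {ffun vertex H -> 'I_k}, proper_coloring c].

(* A hypergraph with an edge of size at most 1 has no proper coloring; its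
   chromatic number is then +oo. *)
Definition chi : \bar rat :=
  if pselect (exists k, colorable k) is left ex
  then ((ex_minn ex)%:R%:E)%R else +oo%E.

End Coloring.

Section KneserHypergraph.
Variables (r : nat) (H : hypergraph).

Definition kneser_vertex : finType := {e : {set vertex H} | e \in edges H}.

Definition kneser_edges : {set {set kneser_vertex}} :=
  [set F : {set kneser_vertex} |
    [exists e : {ffun 'I_r -> kneser_vertex},
      (F == [set e i | i : 'I_r]) &&
      [forall i, forall j, (i != j) ==> [disjoint val (e i) & val (e j)]]]].

Definition kneser : hypergraph := Hypergraph kneser_edges.

End KneserHypergraph.

Section CategoricalProduct.
Variables (I : finType) (G : I -> hypergraph).

Definition cprod_vertex : finType := {dffun forall l : I, vertex (G l)}.

Definition cprod_edges : {set {set cprod_vertex}} :=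
  [set F : {set cprod_vertex} |
    [forall l, [set x l | x : cprod_vertex in F] \in edges (G l)]].

Definition cprod : hypergraph := Hypergraph cprod_edges.

End CategoricalProduct.

Section ColorabilityDefect.
Variable H : hypergraph.

Definition induced_vertex (X : {set vertex H}) : finType :=
  {x : vertex H | x \in X}.

Definition induced_edges (X : {set vertex H}) : {set {set induced_vertex X}} :=
  [set e : {set induced_vertex X} | [set val x | x in e] \in edges H].

Definition induced (X : {set vertex H}) : hypergraph :=
  Hypergraph (induced_edges X).

(* The value +oo (no admissible Y) occurs only when set0 is an edge, since
   otherwise Y = setT is admissible. *)
Definition cd (r : nat) : \bar rat :=
  (\big[Order.min/+oo%E]_(Y : {set vertex H} |
      (chi (induced (~: Y)) <= r%:R%:E)%E) (#|Y|%:R)%:E)%R.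

End ColorabilityDefect.

Lemma colorable_leq (H : hypergraph) (k l : nat) :
  k <= l -> colorable H k -> colorable H l.
Proof.
move=> kl /existsP[c /forall_inP cP].
apply/existsP; exists [ffun x => widen_ord kl (c x)].
apply/forall_inP => e /cP; apply: contra => /forall_inP m.
apply/forall_inP => x xe; apply/forall_inP => y ye.
by have /forall_inP/(_ y ye) := m x xe; rewrite !ffunE.
Qed.

Lemma chi_le (H : hypergraph) (k : nat) :
  (chi H <= (k%:R : rat)%R%:E)%E = colorable H k.
Proof.
rewrite /chi; case: pselect => [ex|nex]; last first.
  by apply/esym/negbTE/negP => ck; apply: nex; exists k.
case: ex_minnP => m cm mmin; rewrite lee_fin ler_nat.
by apply/idP/idP => [mk|/mmin //]; apply: colorable_leq cm.
Qed.

(* Main.v *)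
Require Import Defs.
From mathcomp Require Import all_boot all_order all_algebra.
From mathcomp Require Import boolp constructive_ereal.
From mathcomp Require Import ring zify.

(* Suppose the product is colored with C colors and (r - 1) C is smaller than
   every defect.  If r is prime, give a nonzero sign vector x, with one sign in
   Z_r or None for each vertex of each H_l, the set of signs whose classes
   contain an edge of H_l.  As long as some of these sets is not all of Z_r, x
   is ranked by the sum over l of the largest edge-free part of its support
   plus the size of that set; otherwise, by the largest color met in a single
   sign and the number of signs meeting it.  Without a monochromatic family of
   r pairwise disjoint tuples, every set of signs used has size strictly between
   0 and r, so a barycenter modulo r equips it with an equivariant sign.  The
   rank is then monotone and takes too few values for the Z_r-Tucker lemma.
   Composite r follows by Kriz's induction on the prime factorization.

   The Z_r-Tucker lemma is proved in the cochains of the order complex, by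
   pairing a tower of chains whose boundaries are alternately (g - 1) and
   N = 1 + g + ... + g^(r-1) times the previous one with the corresponding
   tower of cochains on the labels. *)

Set Implicit Arguments.
Unset Strict Implicit.
Unset Printing Implicit Defensive.

Import Order.TTheory GRing.Theory Num.Theory.
Local Open Scope ring_scope.

(** * Cochains and the tower on labels *)

Section Cochains.
Variables (R : comNzRingType) (X : Type).
Implicit Types (phi psi : seq X -> R) (s : seq X).

(* Augmented cochains: a list of size d + 1 stands for a d-simplex. *)
Fixpoint cobd phi s : R :=
  if s is x :: s' then phi s' - cobd (fun t => phi (x :: t)) s' else 0.

Lemma cobdB phi psi s : cobd (fun t => phi t - psi t) s = cobd phi s - cobd psi s.
Proof.
elim: s phi psi => [|x s IH] phi psi /=; first by rewrite subr0.
by rewrite IH; ring.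
Qed.

Lemma cobd0 s : cobd (fun=> 0) s = 0.
Proof. by elim: s => //= x s ->; rewrite subr0. Qed.

Lemma cobd_sum (I : finType) (a : I -> R) (phi : I -> seq X -> R) s :
  cobd (fun t => \sum_i a i * phi i t) s = \sum_i a i * cobd (phi i) s.
Proof.
elim: s phi => [|x s IH] phi /=; first by rewrite big1 // => i _; rewrite mulr0.
by rewrite IH -sumrB; apply: eq_bigr => i _; rewrite mulrBr.
Qed.

Lemma cobdK phi s : cobd (cobd phi) s = 0.
Proof. by elim: s phi => //= x s IH phi; rewrite cobdB IH subr0 subrr. Qed.

(** Vanishing on degenerate simplices. The labels along a chain may repeat, and this property
    discards such chains. *)
Definition normalized phi := forall s1 x s2, phi (s1 ++ x :: x :: s2) = 0.

Lemma cobd_normalized phi : normalized phi -> normalized (cobd phi).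
Proof.
move=> nphi s1; elim: s1 phi nphi => [|a s1 IH] phi nphi x s2 /=.
  have -> : (fun t => phi [:: x, x & t]) = fun=> 0.
    by apply: funext => t; exact: (nphi [::]).
  by rewrite cobd0; ring.
rewrite nphi IH ?subr0 // => s1' y s2'; exact: (nphi (a :: s1')).
Qed.

(* Transpose of the prism operator of the homotopy from the identity to [u]. *)
Fixpoint prism (u : X -> X) phi s : R :=
  if s is x :: s'
  then phi [:: x, u x & map u s'] - prism u (fun t => phi (x :: t)) s' else 0.

Lemma prismB u phi psi s :
  prism u (fun t => phi t - psi t) s = prism u phi s - prism u psi s.
Proof.
elim: s phi psi => [|x s IH] phi psi /=; first by rewrite subr0.
by rewrite IH; ring.
Qed.

(** Transpose of a two-stage contraction: the prism first moves a simplex to its image under [u],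
    and only that image is joined to [e]. In the application [e] lies below the values of [u] but is
    not comparable with every vertex. *)
Definition cone (e : X) (u : X -> X) phi s := phi (e :: map u s) - prism u phi s.

Lemma coneB e u phi psi s :
  cone e u (fun t => phi t - psi t) s = cone e u phi s - cone e u psi s.
Proof. by rewrite /cone prismB; ring. Qed.

End Cochains.

Lemma cobd_map (R : comNzRingType) (X Y : Type) (f : X -> Y)
    (phi : seq Y -> R) (s : seq X) :
  cobd (fun t => phi (map f t)) s = cobd phi (map f s).
Proof. by elim: s phi => //= x s IH phi; rewrite -IH. Qed.

Lemma cobd_prism (R : comNzRingType) (X : Type) (u : X -> X)
    (phi : seq X -> R) (s : seq X) :
  prism u (cobd phi) s + cobd (prism u phi) s = phi (map u s) - phi s.
Proof.
elim: s phi => [|x s IH] phi /=; first by rewrite addr0 subrr.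
rewrite prismB cobdB (cobd_map u (fun t => phi [:: x, u x & t])).
by have := IH (fun t => phi (x :: t)); move/(canRL (addrK _)) => ->; ring.
Qed.

(** Dual form of contractibility: the prism formula compares a simplex with its image under [u], and
    joining that image to [e] cancels the image term. *)
Lemma cobd_cone (R : comNzRingType) (X : Type) (e : X) (u : X -> X)
    (phi : seq X -> R) (s : seq X) :
  cone e u (cobd phi) s = phi s - cobd (cone e u phi) s.
Proof.
rewrite /cone cobdB (cobd_map u (fun t => phi (e :: t))) /=.
by have /(canRL (addrK _)) -> := cobd_prism u phi s; ring.
Qed.

(** * Operators of the group ring of the cyclic group acting on cochains *)

Section GroupRing.
Variables (q : nat) (X : Type).
Local Notation Z := 'I_q.+2.
Variable act : Z -> X -> X.
Hypothesis actD : forall k l x, act k (act l x) = act (k + l) x.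
Implicit Types (phi psi : seq X -> Z) (s : seq X) (a : Z -> Z).

Definition conv a phi s : Z := \sum_k a k * phi (map (act k) s).
Definition trace := conv (fun=> 1).
Definition tau phi s : Z := phi (map (act 1) s) - phi s.
(* Since q.+2 = 0 in Z, (g - 1) * (- \sum_k k g^k) is the norm. *)
Definition qop := conv (fun k => - k).

Lemma map_actD k l s : map (act k) (map (act l) s) = map (act (k + l)) s.
Proof. by rewrite -map_comp; apply: eq_map => x /=; rewrite actD. Qed.

Lemma convB a phi psi s :
  conv a (fun t => phi t - psi t) s = conv a phi s - conv a psi s.
Proof. by rewrite /conv -sumrB; apply: eq_bigr => k _; rewrite mulrBr. Qed.

Lemma cobd_conv a phi s : cobd (conv a phi) s = conv a (cobd phi) s.
Proof.
rewrite /conv cobd_sum; apply: eq_bigr => k _; congr (_ * _); exact: cobd_map.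
Qed.

Lemma tauB phi psi s : tau (fun t => phi t - psi t) s = tau phi s - tau psi s.
Proof. by rewrite /tau; ring. Qed.

Lemma cobd_tau phi s : cobd (tau phi) s = tau (cobd phi) s.
Proof. by rewrite /tau cobdB cobd_map. Qed.

Lemma conv_shift a phi s :
  \sum_k a k * phi (map (act (k + 1)) s) = \sum_k a (k - 1) * phi (map (act k) s).
Proof.
rewrite [RHS](reindex_inj (addIr 1)); apply: eq_bigr => k _.
by rewrite addrK.
Qed.

Lemma tau_conv a phi s : tau (conv a phi) s = conv (fun k => a (k - 1) - a k) phi s.
Proof.
rewrite /tau /conv.
under eq_bigr do rewrite map_actD.
rewrite conv_shift -sumrB; apply: eq_bigr => k _; ring.
Qed.

Lemma conv_tau a phi s : conv a (tau phi) s = conv (fun k => a (k - 1) - a k) phi s.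
Proof.
rewrite /tau /conv.
under eq_bigr do rewrite map_actD mulrBr [1 + _]addrC.
rewrite sumrB conv_shift -sumrB; apply: eq_bigr => k _; ring.
Qed.

Lemma conv0 phi s : conv (fun=> 0) phi s = 0.
Proof. by rewrite /conv big1 // => k _; rewrite mul0r. Qed.

Lemma tau_trace phi s : tau (trace phi) s = 0.
Proof.
rewrite tau_conv -[RHS](conv0 phi s); congr conv.
by apply: funext => k; rewrite subrr.
Qed.

Lemma trace_tau phi s : trace (tau phi) s = 0.
Proof.
rewrite /trace conv_tau -[RHS](conv0 phi s); congr conv.
by apply: funext => k; rewrite subrr.
Qed.

Lemma qopE : (fun k : Z => - (k - 1) - - k) = fun=> 1.
Proof. by apply: funext => k; ring. Qed.

Lemma tau_qop phi s : tau (qop phi) s = trace phi s.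
Proof. by rewrite tau_conv qopE. Qed.

Lemma qop_tau phi s : qop (tau phi) s = trace phi s.
Proof. by rewrite /qop conv_tau qopE. Qed.

End GroupRing.

(** * The tower of cochains on signed labels *)

Section LabelTower.
Variable q : nat.
Local Notation Z := 'I_q.+2.
Definition label := (Z * nat)%type.
Definition lact (k : Z) (w : label) : label := (w.1 + k, w.2).
Implicit Types (phi psi : seq label -> Z) (s : seq label).

Lemma lactD k l w : lact k (lact l w) = lact (k + l) w.
Proof. by case: w => e j; rewrite /lact /=; congr pair; ring. Qed.

Lemma map_lact0 s : map (lact 0) s = s.
Proof.
by rewrite -[RHS]map_id; apply: eq_map => -[e j]; rewrite /lact /= addr0.
Qed.

Local Notation tr := (trace lact).
Local Notation tau := (tau lact).

(** Lists whose first sign is 0 form a fundamental domain of the free action on nonempty lists, so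
    an invariant cochain is the trace of its restriction to them. *)
Definition inv_trace phi s : Z :=
  if s is w :: _ then (w.1 == 0)%:R * phi s else 0.

(** Sum over the translates whose first sign precedes that of the list. Passing to the next sign
    adds one term, so [tau] telescopes. *)
Definition inv_tau phi s : Z :=
  if s is w :: _ then \sum_(i : Z | (i < w.1)%N) phi (map (lact (i - w.1)) s) else 0.

Lemma tau0_inv phi s k : (forall t, tau phi t = 0) -> phi (map (lact k) s) = phi s.
Proof.
move=> tau0.
have inv1 t : phi (map (lact 1) t) = phi t.
  by apply/eqP; rewrite -subr_eq0; apply/eqP/tau0.
rewrite -[k]natr_Zp; elim: (nat_of_ord k) => [|n IH]; first by rewrite map_lact0.
by rewrite -natr1 addrC -(map_actD lactD) inv1.
Qed.

Lemma trace_inv_trace phi : phi [::] = 0 -> (forall t, tau phi t = 0) ->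
  forall s, tr (inv_trace phi) s = phi s.
Proof.
move=> phi0 tau0 [|w s]; rewrite /trace /conv.
  by rewrite phi0 big1 // => k _; rewrite mulr0.
rewrite (bigD1 (- w.1)) //= subrr eqxx !mul1r big1 => [|k kw].
  by rewrite addr0; exact: (@tau0_inv _ (w :: s)).
by rewrite addrC addr_eq0 (negbTE kw) mul0r mulr0.
Qed.

Lemma tau_inv_tau phi : phi [::] = 0 -> (forall t, tr phi t = 0) ->
  forall s, tau (inv_tau phi) s = phi s.
Proof.
move=> phi0 tr0 [|w s]; first by rewrite phi0 /tau subrr.
have invE w' s' : inv_tau phi (w' :: s') =
  \sum_(i : Z | (i < w'.1)%N) phi (map (lact (i - w'.1)) (w' :: s')) by [].
rewrite /tau (_ : map (lact 1) (w :: s) = lact 1 w :: map (lact 1) s) // !invE.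
set F : Z -> Z := fun i => phi (map (lact (i - w.1)) (w :: s)).
rewrite -[X in X - _]/(\sum_(i : Z | (i < (w.1 + 1)%R)%N) _).
have -> : \sum_(i : Z | (i < (w.1 + 1)%R)%N)
    phi (map (lact (i - (lact 1 w).1)) (lact 1 w :: map (lact 1) s))
    = \sum_(i : Z | (i < (w.1 + 1)%R)%N) F i.
  apply: eq_bigr => i _.
  rewrite /F -[_ :: map _ s]/(map (lact 1) (w :: s)) (map_actD lactD).
  by congr (phi (map (lact _) _)); rewrite /lact [LHS]/=; ring.
rewrite -[X in _ - X]/(\sum_(i : Z | (i < w.1)%N) F i).
have Fw : F w.1 = phi (w :: s) by rewrite /F subrr map_lact0.
have sumF : \sum_i F i = 0.
  rewrite -[RHS](tr0 (w :: s)) /trace /conv (reindex_inj (addIr w.1)).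
  by apply: eq_bigr => k _; rewrite /F addrK mul1r.
have w_lt := ltn_ord w.1.
have [wlt|wge] := ltnP w.1.+1 q.+2.
  have val1 : (w.1 + 1)%R = w.1.+1 :> nat.
    by rewrite /= /Zp_add /= ?modn_small //; lia.
  rewrite (bigD1 w.1) ?val1 // Fw.
  rewrite (eq_bigl (fun i : Z => (i < w.1)%N)) ?addrK // => i.
  by rewrite -val_eqE /=; lia.
(* The successor of the last sign is 0, where the sum is empty; since the trace vanishes, minus the
   sum of the other terms is the term at [w.1]. *)
have val0 : (w.1 + 1)%R = 0%N :> nat.
  have -> : w.1 = ord_max by apply: val_inj => /=; lia.
  by rewrite /= ?modn_mod; rewrite -?[(1 %% _)%N]/1%N addn1 modnn.
rewrite big_pred0 => [|i]; last by rewrite val0.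
move: sumF; rewrite (bigD1 w.1) // Fw sub0r => /eqP.
rewrite addr_eq0 => /eqP ->; congr (- _); apply: eq_bigl => i.
by have := ltn_ord i; rewrite -val_eqE /=; lia.
Qed.

(** The start is the indicator of the vertices of sign 0; then [tau] and the trace are inverted in
    turn. Freeness of the action makes this possible in every degree. *)
Fixpoint btower d : seq label -> Z :=
  if d is d'.+1 then
    if odd d then inv_tau (cobd (btower d')) else inv_trace (cobd (btower d'))
  else fun s => if s is [:: w] then (w.1 == 0)%:R else 0.

Lemma btowerS d : btower d.+1 =
  if ~~ odd d then inv_tau (cobd (btower d)) else inv_trace (cobd (btower d)).
Proof. by []. Qed.

Lemma trace_btower0 s : tr (btower 0) s = (size s == 1%N)%:R.
Proof.
rewrite /trace /conv; case: s => [|w [|w' s]] /=.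
- by rewrite big1 // => k _; rewrite mulr0.
- rewrite (bigD1 (- w.1)) //= subrr eqxx mul1r big1 ?addr0 // => k kw.
  by rewrite addrC addr_eq0 (negbTE kw) mulr0.
- by rewrite big1 // => k _; rewrite mulr0.
Qed.

(** This is the condition for the next inversion. It persists because [cobd] commutes with [tau] and
    the trace and squares to zero; at the start, the trace of [btower 0] is the coboundary of the
    indicator of the empty list. *)
Lemma cobd_cocycle d :
  if odd d then forall s, tau (cobd (btower d)) s = 0
  else forall s, tr (cobd (btower d)) s = 0.
Proof.
elim: d => [s|d].
  rewrite /trace -cobd_conv.
  have -> : conv lact (fun=> 1) (btower 0) = cobd (fun t => (size t == 0%N)%:R).
    apply: funext => t; have := trace_btower0 t; rewrite /trace => ->.
    by case: t => //= w t; rewrite cobd0 subr0.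
  exact: cobdK.
rewrite oddS btowerS; case: (odd d) => IH s.
  rewrite /trace -cobd_conv.
  have -> : conv lact (fun=> 1) (inv_trace (cobd (btower d))) = cobd (btower d).
    by apply: funext => t; exact: trace_inv_trace.
  exact: cobdK.
rewrite -cobd_tau.
have -> : tau (inv_tau (cobd (btower d))) = cobd (btower d).
  by apply: funext => t; exact: tau_inv_tau.
exact: cobdK.
Qed.

Lemma btower_odd d s : ~~ odd d -> tau (btower d.+1) s = cobd (btower d) s.
Proof.
move=> oddd; have := cobd_cocycle d; rewrite btowerS oddd (negbTE oddd) => tr0.
exact: tau_inv_tau.
Qed.

Lemma btower_even d s : odd d -> tr (btower d.+1) s = cobd (btower d) s.
Proof.
move=> oddd; have := cobd_cocycle d; rewrite btowerS oddd => tau0.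
exact: trace_inv_trace.
Qed.

Lemma btower_normalized d : normalized (btower d).
Proof.
elim: d => [|d IH].
  by move=> [|w [|w' s]] x t.
have nc := cobd_normalized IH.
rewrite btowerS; case: ifP => _.
  move=> s1 x s2; rewrite /inv_tau.
  case E : (s1 ++ _) => [|w t] //; rewrite -E.
  by rewrite big1 // => i _; rewrite map_cat /= nc.
move=> s1 x s2; rewrite /inv_trace.
by case E : (s1 ++ _) => [|w t] //; rewrite -E nc mulr0.
Qed.

(** The relation between labels of comparable sign vectors: the rank grows, or the whole label is
    unchanged. *)
Definition lrel (w w' : label) := (w.2 < w'.2)%N || (w == w').

Lemma normalized_sorted phi s : normalized phi -> sorted lrel s ->
  phi s != 0 -> sorted ltn (map snd s).
Proof.
elim: s phi => [|w [|w' s] IH] phi //= nphi /andP[ww' ps] phin0.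
apply/andP; split.
  by case/orP: ww' => // /eqP ww'; rewrite ww' (nphi [::]) eqxx in phin0.
apply: (IH (fun t => phi (w :: t))) => // s1 x s2; exact: (nphi (w :: s1)).
Qed.

(** Pigeonhole: where a normalized cochain is nonzero the ranks increase strictly, and [n] of them
    do not fit between 1 and [n - 1]. *)
Lemma normalized_vanish phi s n : normalized phi -> sorted lrel s ->
  all (fun w => 0 < w.2 < n)%N s -> (n <= size s)%N -> (0 < n)%N -> phi s = 0.
Proof.
move=> nphi ss /allP all_s size_s n_gt0; apply/eqP; apply: contraLR size_s => phin0.
have srt := normalized_sorted nphi ss phin0.
have u := sorted_uniq ltn_trans ltnn srt.
have sub : {subset map snd s <= iota 1 n.-1}.
  by move=> j /mapP[w /all_s hw ->]; rewrite mem_iota; lia.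
rewrite -ltnNge -(size_map snd); apply: leq_ltn_trans (uniq_leq_size u sub) _.
by rewrite size_iota prednK.
Qed.

End LabelTower.

(** * The monotone Z_p-Tucker lemma *)

Section SignVectors.
Variables (q : nat) (N : finType).
Local Notation Z := 'I_q.+2.
Definition svec := {ffun N -> option Z}.
Implicit Types (x y : svec) (s : seq svec) (phi psi : seq svec -> Z).

Definition sact (k : Z) x : svec := [ffun v => omap (fun e => e + k) (x v)].
Definition sle x y := [forall v, (x v != None) ==> (y v == x v)].
Definition snz x := [exists v, x v != None].

Lemma sactD k l x : sact k (sact l x) = sact (k + l) x.
Proof.
by apply/ffunP => v; rewrite !ffunE; case: (x v) => //= e; congr Some; ring.
Qed.

Lemma sact_None k x v : (sact k x v == None) = (x v == None).
Proof. by rewrite ffunE; case: (x v). Qed.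

Lemma sle_sact k x y : sle (sact k x) (sact k y) = sle x y.
Proof.
apply: eq_forallb => v; rewrite !ffunE; case: (x v) (y v) => [e|] [f|] //=.
by rewrite !(inj_eq Some_inj) (inj_eq (addIr k)).
Qed.

Lemma snz_sact k x : snz (sact k x) = snz x.
Proof. by apply: eq_existsb => v; rewrite sact_None. Qed.

Lemma sleP x y : reflect (forall v e, x v = Some e -> y v = Some e) (sle x y).
Proof.
apply: (iffP forallP) => [h v e xv|h v].
  by have := h v; rewrite xv => /eqP.
by apply/implyP; case E : (x v) => [e|] // _; rewrite (h v e E).
Qed.

(** * The tower of chains of sign vectors, built as functionals on cochains *)

Section Tower.
Variables (pt : nat -> N) (idx : N -> nat).
Hypothesis ptK : forall d, (d < #|N|)%N -> idx (pt d) = d.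

Definition setv d x : svec := [ffun v => if v == pt d then Some 0 else x v].
Definition apex d : svec := setv d [ffun=> None].
Definition supp_le d x := [forall v, (x v != None) ==> (idx v <= d)%N].
Definition valid d s := pairwise sle s && all (fun x => snz x && supp_le d x) s.

Lemma valid_sact d k s : valid d s -> valid d (map (sact k) s).
Proof.
case/andP=> ps als; apply/andP; split.
  rewrite pairwise_map; apply: sub_pairwise ps => x y; by rewrite /= sle_sact.
rewrite all_map; apply: sub_all als => x /= /andP[nx /forallP sx].
by rewrite snz_sact nx; apply/forallP => v; rewrite sact_None.
Qed.

Lemma supp_leS d x : supp_le d x -> supp_le d.+1 x.
Proof.
move=> /forallP sx; apply/forallP => v; apply/implyP => /(implyP (sx v)).
exact: leqW.
Qed.

Lemma supp_le_None d x : (d.+1 < #|N|)%N -> supp_le d x -> x (pt d.+1) = None.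
Proof.
move=> dN /forallP/(_ (pt d.+1)); rewrite ptK // ltnn implybF negbK.
by move/eqP.
Qed.

Lemma snz_setv d x : snz (setv d x).
Proof. by apply/existsP; exists (pt d); rewrite ffunE eqxx. Qed.

Lemma supp_le_setv d x : (d.+1 < #|N|)%N -> supp_le d x -> supp_le d.+1 (setv d.+1 x).
Proof.
move=> dN /supp_leS/forallP sx; apply/forallP => v; rewrite ffunE.
by case: (v =P pt _) => [->|_]; [rewrite ptK // leqnn implybT|exact: sx].
Qed.

Lemma supp_le_apex d : (d < #|N|)%N -> supp_le d (apex d).
Proof.
move=> dN; apply/forallP => v; rewrite !ffunE.
by case: (v =P pt _) => [->|_] //; rewrite ptK // leqnn implybT.
Qed.

Lemma sle_setv d x y : sle x y -> sle (setv d x) (setv d y).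
Proof.
by move=> /sleP xy; apply/sleP => v e; rewrite !ffunE; case: (v =P pt _) => // _ /xy.
Qed.

Lemma sle_apex d x : sle (apex d) (setv d x).
Proof.
by apply/sleP => v e; rewrite !ffunE; case: (v =P pt _) => // _; rewrite ffunE.
Qed.

Lemma sle_setvr d x y : (d.+1 < #|N|)%N -> supp_le d x -> sle x y ->
  sle x (setv d.+1 y).
Proof.
move=> dN sx /sleP xy; apply/sleP => v e xv; rewrite ffunE (xy _ _ xv).
by case: (v =P pt _) => // vd; rewrite vd (supp_le_None dN sx) in xv.
Qed.

Lemma sle_refl x : sle x x.
Proof. exact/sleP. Qed.

(** All vectors involved vanish at coordinate [d.+1], so [setv d.+1] only enlarges them and the
    simplices of the prism are again chains. *)
Lemma valid_prism d s1 x s2 : (d.+1 < #|N|)%N -> valid d (s1 ++ x :: s2) ->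
  valid d.+1 (s1 ++ x :: setv d.+1 x :: map (setv d.+1) s2).
Proof.
move=> dN /andP[]; rewrite pairwise_cat => /and3P[r12 p1 /= /andP[rx p2]].
rewrite all_cat /= => /and3P[a1 ax a2].
have [_ sx] := andP ax.
have up y : snz y && supp_le d y -> snz y && supp_le d.+1 y.
  by case/andP=> -> /supp_leS ->.
rewrite /valid pairwise_cat p1 all_cat /= (sub_all up a1) up // snz_setv.
rewrite supp_le_setv // !all_map !pairwise_map !andbT /=.
rewrite sle_setvr ?sle_refl //=.
have -> : all (preim (setv d.+1) (sle x)) s2.
  by apply: sub_all rx => y; exact: sle_setvr.
have -> : all (preim (setv d.+1) (sle (setv d.+1 x))) s2.
  by apply: sub_all rx => y; exact: sle_setv.
have -> : pairwise (relpre (setv d.+1) sle) s2.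
  by apply: sub_pairwise p2 => y z; exact: sle_setv.
have -> : all (preim (setv d.+1) (fun x0 => snz x0 && supp_le d.+1 x0)) s2.
  by apply: sub_all a2 => y /= /andP[_ sy]; rewrite snz_setv supp_le_setv.
rewrite !andbT /allrel; apply/allP => y ys1.
have /andP[_ sy] := allP a1 _ ys1.
move/allP/(_ _ ys1): r12 => /= /andP[yx ys2].
rewrite yx sle_setvr //= all_map; apply: sub_all ys2 => z; exact: sle_setvr.
Qed.

Lemma valid_cone d s : (d.+1 < #|N|)%N -> valid d s ->
  valid d.+1 (apex d.+1 :: map (setv d.+1) s).
Proof.
move=> dN /andP[ps als].
rewrite /valid /= !all_map pairwise_map snz_setv supp_le_apex //=.
have -> : all (preim (setv d.+1) (sle (apex d.+1))) s.
  by apply/allP => y _; exact: sle_apex.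
have -> : pairwise (relpre (setv d.+1) sle) s.
  by apply: sub_pairwise ps => y z; exact: sle_setv.
by apply: sub_all als => y /= /andP[_ sy]; rewrite snz_setv supp_le_setv.
Qed.

(** Cochains are compared only on the simplices seen by the functional of degree [d]; the labels are
    equivariant and monotone only on nonzero vectors. *)
Definition eq_valid d phi psi :=
  forall s, size s = d.+1 -> valid d s -> phi s = psi s.

Lemma cone_ext d phi psi : (d.+1 < #|N|)%N -> eq_valid d.+1 phi psi ->
  eq_valid d (cone (apex d.+1) (setv d.+1) phi) (cone (apex d.+1) (setv d.+1) psi).
Proof.
move=> dN eqp s size_s vs; rewrite /cone eqp /= ?size_map ?size_s ?valid_cone //.
congr (_ - _).
(* The recursion of [prism] pushes entries into the argument of the cochain, so the claim carries a
   prefix [s1]. *)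
suff gen s1 s2 : valid d (s1 ++ s2) -> size (s1 ++ s2) = d.+1 ->
    prism (setv d.+1) (fun t => phi (s1 ++ t)) s2 =
    prism (setv d.+1) (fun t => psi (s1 ++ t)) s2 by exact: (gen [::]).
elim: s2 s1 => [|x s2 IH] s1 v12 size12 //=; congr (_ - _).
  apply: eqp; last exact: valid_prism.
  by move: size12; rewrite !size_cat /= size_map; lia.
have := IH (rcons s1 x); rewrite cat_rcons => /(_ v12 size12).
have E (phi' : seq svec -> Z) :
    (fun t => phi' (rcons s1 x ++ t)) = (fun t => phi' (s1 ++ x :: t)).
  by apply: funext => t; rewrite cat_rcons.
by rewrite !E.
Qed.

Definition rop d : (seq svec -> Z) -> seq svec -> Z :=
  if odd d then tau sact else trace sact.

(* Evaluation at a chain c_d with boundary c_{d+1} = (g - 1) c_d or N c_d, where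
   c_{d+1} fills that cycle by coning with the apex on the next coordinate; only
   the functional is built. *)
Fixpoint htower d phi : Z :=
  if d is d'.+1 then htower d' (rop d (cone (apex d) (setv d) phi))
  else phi [:: apex 0].

Lemma conv_ext a d phi psi : eq_valid d phi psi ->
  eq_valid d (conv sact a phi) (conv sact a psi).
Proof.
move=> eqp s size_s vs; apply: eq_bigr => k _; congr (_ * _).
by apply: eqp; rewrite ?size_map ?valid_sact.
Qed.

Lemma tau_ext d phi psi : eq_valid d phi psi ->
  eq_valid d (tau sact phi) (tau sact psi).
Proof.
by move=> eqp s size_s vs; rewrite /tau !eqp ?size_map ?valid_sact.
Qed.

Lemma rop_ext d' d phi psi : eq_valid d phi psi ->
  eq_valid d (rop d' phi) (rop d' psi).
Proof. by rewrite /rop; case: ifP => _; [exact: tau_ext|exact: conv_ext]. Qed.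

Lemma ropB d phi psi s : rop d (fun t => phi t - psi t) s = rop d phi s - rop d psi s.
Proof. by rewrite /rop; case: ifP => _; [exact: tauB|exact: convB]. Qed.

Lemma cobd_rop d phi s : cobd (rop d phi) s = rop d (cobd phi) s.
Proof. by rewrite /rop; case: ifP => _; [exact: cobd_tau|exact: cobd_conv]. Qed.

Lemma rop_rop d phi s : rop d (rop d.+1 phi) s = 0.
Proof.
rewrite /rop oddS; case: (odd d) => /=.
  exact: (tau_trace sactD).
exact: (trace_tau sactD).
Qed.

Lemma htower_ext d phi psi : (d < #|N|)%N -> eq_valid d phi psi ->
  htower d phi = htower d psi.
Proof.
elim: d phi psi => [|d IH] phi psi dN eqp /=.
  by apply: eqp => //; rewrite /valid /= snz_setv supp_le_apex.
by apply: IH (ltnW dN) _; apply: rop_ext; exact: cone_ext.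
Qed.

Lemma htowerB d phi psi :
  htower d (fun t => phi t - psi t) = htower d phi - htower d psi.
Proof.
elim: d phi psi => [|d IH] phi psi //=.
rewrite -IH; congr htower; apply: funext => s; rewrite -ropB; congr (rop _ _ s).
by apply: funext => t; exact: coneB.
Qed.

Lemma htower0 d : htower d (fun=> 0) = 0.
Proof.
by have := htowerB d (fun=> 0) (fun=> 0); rewrite !subrr.
Qed.

Lemma rop_cone_cobd d e u phi : rop d (cone e u (cobd phi)) =
  fun s => rop d phi s - cobd (rop d (cone e u phi)) s.
Proof.
apply: funext => s; rewrite cobd_rop -ropB; congr (rop _ _ s).
by apply: funext => t; exact: cobd_cone.
Qed.

Lemma htowerS d phi :
  htower d.+1 phi = htower d (rop d.+1 (cone (apex d.+1) (setv d.+1) phi)).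
Proof. by []. Qed.

(** Stokes' formula for the tower. The cone formula leaves an error term, a coboundary; by induction
    it is evaluated through two consecutive operators [rop], whose composite is zero. *)
Lemma htower_cobd d phi : htower d.+1 (cobd phi) = htower d (rop d.+1 phi).
Proof.
elim: d phi => [|d IH] phi; rewrite htowerS rop_cone_cobd htowerB.
  rewrite [htower 0 (cobd _)]/= [rop 1 _ [::]]/= /rop /= {2}/tau.
  by rewrite subrr !subr0.
set c := cone _ _ _; rewrite (IH (rop d.+2 c)).
have -> : rop d.+1 (rop d.+2 c) = fun=> 0.
  by apply: funext => s; exact: rop_rop.
by rewrite htower0 subr0.
Qed.

End Tower.

Lemma cover_tower : (0 < #|N|)%N -> exists pt : nat -> N, exists idx : N -> nat,
  forall d, (d < #|N|)%N -> idx (pt d) = d.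
Proof.
case/card_gt0P => v0 _; exists (nth v0 (enum N)), (index^~ (enum N)) => d dN.
by rewrite index_uniq ?enum_uniq // -cardE.
Qed.

(* Pairing the two towers: [htower d] evaluated at the norm of the pulled back
   [btower d] is 1 for every [d]; in degree [#|N| - 1] the latter vanishes. *)
Lemma monotone_Zp_tucker (sgn : svec -> Z) (rk : svec -> nat) :
  (0 < #|N|)%N ->
  (forall x, snz x -> 0 < rk x < #|N|)%N ->
  (forall k x, snz x -> sgn (sact k x) = sgn x + k) ->
  (forall k x, snz x -> rk (sact k x) = rk x) ->
  (forall x y, snz x -> sle x y -> (rk x <= rk y)%N) ->
  (forall x y, snz x -> sle x y -> rk x = rk y -> sgn x = sgn y) ->
  False.
Proof.
move=> N_gt0 rk_bd sgn_act rk_act rk_le sgn_eq.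
have [pt [idx ptK]] := cover_tower N_gt0.
pose lam x : label q := (sgn x, rk x).
pose b d s := @btower q d (map lam s).
have valid_nz d s : valid idx d s -> {in s, forall x, snz x}.
  by case/andP=> _ /allP als x /als /andP[].
have lam_act k s d : valid idx d s ->
    map lam (map (sact k) s) = map (lact k) (map lam s).
  move=> /valid_nz nz; rewrite -!map_comp; apply/eq_in_map => x /nz nx.
  by rewrite /lam /lact /= sgn_act // rk_act.
have convL a d (phi : seq (label q) -> Z) :
    eq_valid idx d (conv sact a (fun s => phi (map lam s)))
    (fun s => conv (@lact q) a phi (map lam s)).
  by move=> s _ vs; apply: eq_bigr => k _; rewrite (lam_act _ _ _ vs).
have tauL d (phi : seq (label q) -> Z) :
    eq_valid idx d (tau sact (fun s => phi (map lam s)))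
    (fun s => tau (@lact q) phi (map lam s)).
  by move=> s _ vs; rewrite /tau (lam_act _ _ _ vs).
have cobdL d : cobd (b d) = fun s => cobd (@btower q d) (map lam s).
  by apply: funext => s; exact: cobd_map.
have one d : (d < #|N|)%N -> htower pt d (trace sact (b d)) = 1.
  elim: d => [|d IH] dN.
    have nz0 : valid idx 0 [:: apex pt 0].
      by rewrite /valid /= snz_setv (supp_le_apex ptK).
    by rewrite /= /trace (convL _ 0%N) // -/(trace _ _ _) trace_btower0.
  rewrite -(IH (ltnW dN)); case: (boolP (odd d)) => oddd.
    have := htower_cobd pt d (b d); rewrite /rop oddS oddd => <-.
    apply: (htower_ext ptK dN) => s size_s vs.
    by rewrite cobdL -(btower_even _ oddd) /trace (convL _ d.+1).
  (* For even [d] the boundary of the next chain is (g - 1) times the current one, so the norm is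
     factored through [tau]; the factor [qop] then meets the [tau] of the next label cochain and
     restores a trace. *)
  have -> : trace sact (b d) = rop d.+1 (qop sact (b d)).
    by rewrite /rop oddS oddd; apply: funext => s; rewrite (tau_qop sactD).
  rewrite -htower_cobd; apply: (htower_ext ptK dN) => s size_s vs.
  rewrite cobd_conv -(qop_tau sactD).
  apply: (conv_ext _ _ size_s vs) => t size_t vt.
  rewrite cobdL -(btower_odd _ oddd).
  exact: (tauL d.+1).
have nN : (#|N|.-1 < #|N|)%N by rewrite prednK.
suff eq0 : eq_valid idx #|N|.-1 (trace sact (b #|N|.-1)) (fun=> 0).
  have := one _ nN; rewrite (htower_ext ptK nN eq0) htower0 => /esym/eqP.
  by rewrite oner_eq0.
move=> s; rewrite prednK // => size_s vs.
rewrite /trace /conv big1 // => k _; rewrite mul1r.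
have vk := valid_sact k vs.
have nzk := valid_nz _ _ vk.
apply: (normalized_vanish (n := #|N|)) => //.
- exact: btower_normalized.
- apply: pairwise_sorted; rewrite pairwise_map.
  case/andP: vk => pk _; move: pk nzk; move: (map _ s) => t.
  elim: t => //= x t IHt /andP[xt pt'] nzt; rewrite IHt ?andbT //; last first.
    by move=> y yt; apply: nzt; rewrite inE yt orbT.
  have nx : snz x by apply: nzt; rewrite mem_head.
  apply: sub_all xt => y xy; rewrite /= /lrel /= ltn_neqAle rk_le // andbT.
  case: eqP => //= rxy; apply/eqP; rewrite /lam rxy; congr pair; exact: sgn_eq.
- by apply/allP => _ /mapP[x /nzk nx ->]; exact: rk_bd.
- by rewrite !size_map size_s.
Qed.

End SignVectors.

(** * Prime r *)

Section ShiftedSets.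
Variable q : nat.
Local Notation Z := 'I_q.+2.
Implicit Types A : {set Z}.

Definition shift (k : Z) A := (+%R^~ k) @: A.

Lemma mem_shift k A i : (i \in shift k A) = (i - k \in A).
Proof. by rewrite -[in LHS](subrK k i) (mem_imset _ _ (addIr k)). Qed.

Lemma card_shift k A : #|shift k A| = #|A|.
Proof. by rewrite card_imset //; exact: addIr. Qed.

Lemma shift_eq0 k A : (shift k A == set0) = (A == set0).
Proof. by rewrite -!cards_eq0 card_shift. Qed.

Lemma shift_eqT k A : (shift k A == setT) = (A == setT).
Proof. by rewrite !eqEcard !subsetT card_shift. Qed.

Definition proper_set A := (A != set0) && (A != setT).

Lemma proper_shift k A : proper_set (shift k A) = proper_set A.
Proof. by rewrite /proper_set shift_eq0 shift_eqT. Qed.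

Lemma proper_set_card A : proper_set A -> (0 < #|A| < q.+2)%N.
Proof.
case/andP=> A0 AT; rewrite card_gt0 A0.
have := proper_card (etrans (properT A) AT).
by rewrite cardsT card_ord.
Qed.

Definition barycenter A : Z := (\sum_(a in A) a) / #|A|%:R.

(* Primality is used only here: it makes #|A| invertible modulo q.+2. *)
Lemma barycenter_shift k A : prime q.+2 -> proper_set A ->
  barycenter (shift k A) = barycenter A + k.
Proof.
move=> pr /proper_set_card /andP[A_gt0 A_lt].
have unitA : (#|A|%:R : Z) \is a GRing.unit.
  rewrite (@unitZpE q.+2) // prime_coprime // gtnNdvd //.
rewrite /barycenter card_shift big_imset /=; last by move=> i j _ _ /addIr.
by rewrite big_split /= sumr_const mulrDl -[k *+ _]mulr_natr mulrK.
Qed.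

End ShiftedSets.

(** * Partial colorings and the strengthened bound *)

Definition cls (T S : finType) (x : {ffun T -> option S}) (i : S) : {set T} :=
  [set v | x v == Some i].

Definition mono_free (T S : finType) (E : {set {set T}})
    (x : {ffun T -> option S}) :=
  [forall e in E, forall i, ~~ (e \subset cls x i)].

(* [d] is at most the [#|S|]-colorability defect; the value [None] marks the
   deleted vertices. *)
Definition defect_ge (S T : finType) (E : {set {set T}}) (d : nat) : Prop :=
  forall x : {ffun T -> option S}, mono_free E x -> (d <= #|[set v | x v == None]|)%N.

(* The conclusion gives more than a monochromatic edge of the product: its
   coordinates are matched bijectively. This is what survives the induction on
   the number of prime factors of [r]. *)
Definition kneser_product_bound (r : nat) : Prop :=
  forall (I T : finType) (E : I -> {set {set T}}) (C : nat)
    (c : {ffun I -> {set T}} -> 'I_C),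
  (0 < #|I|)%N -> (forall l, set0 \notin E l) ->
  (forall l, defect_ge 'I_r (E l) (r.-1 * C).+1) ->
  exists e : 'I_r -> {ffun I -> {set T}},
    [/\ forall i l, e i l \in E l,
        forall i j l, i != j -> [disjoint e i l & e j l]
      & forall i j, c (e i) = c (e j)].

Section PrimeCase.
Variables (q : nat) (I T : finType) (E : I -> {set {set T}}) (C : nat).
Variable c : {ffun I -> {set T}} -> 'I_C.
Local Notation Z := 'I_q.+2.
Hypothesis prime_p : prime q.+2.
Hypothesis I_gt0 : (0 < #|I|)%N.
Hypothesis E0 : forall l, set0 \notin E l.
Hypothesis E_defect : forall l, defect_ge Z (E l) (q.+1 * C).+1.
Hypothesis no_mono : forall e : Z -> {ffun I -> {set T}},
  (forall i l, e i l \in E l) ->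
  (forall i j l, i != j -> [disjoint e i l & e j l]) ->
  ~ (forall i j, c (e i) = c (e j)).

Local Notation svec := (svec q (I * T)%type).
Implicit Types (x y : svec) (l : I) (i k : Z).

(** * Levels: the contribution of a single hypergraph to the rank *)

Definition part x l : {ffun T -> option Z} := [ffun v => x (l, v)].
Definition supp x l := [set v | x (l, v) != None].
Definition hit x l := [set i | [exists e in E l, e \subset cls (part x l) i]].
Definition free_in x l (Y : {set T}) :=
  (Y \subset supp x l) &&
  [forall e in E l, forall i, ~~ (e \subset Y :&: cls (part x l) i)].
Definition free_size x l := \max_(Y : {set T} | free_in x l Y) #|Y|.
(** Once all signs are hit, the size of the support takes over. It dominates the other formula, so
    monotonicity survives, and its constancy freezes the vector on this hypergraph. *)
Definition level x l :=
  if hit x l == setT then #|supp x l| else (free_size x l + #|hit x l|)%N.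

Lemma cls_partE x l i v : (v \in cls (part x l) i) = (x (l, v) == Some i).
Proof. by rewrite inE ffunE. Qed.

Lemma cls_partS x y l i : sle x y -> cls (part x l) i \subset cls (part y l) i.
Proof.
move=> /sleP xy; apply/subsetP => v; rewrite !cls_partE => /eqP xv.
by rewrite (xy _ _ xv).
Qed.

Lemma suppS x y l : sle x y -> supp x l \subset supp y l.
Proof.
move=> /sleP xy; apply/subsetP => v; rewrite !inE.
by case xv : (x (l, v)) => [e|] // _; rewrite (xy _ _ xv).
Qed.

Lemma hitS x y l : sle x y -> hit x l \subset hit y l.
Proof.
move=> xy; apply/subsetP => i; rewrite !inE => /exists_inP[e eE ex].
by apply/exists_inP; exists e => //; apply: subset_trans ex (cls_partS _ _ xy).
Qed.

Lemma supp_eq x y l : sle x y -> (#|supp y l| <= #|supp x l|)%N ->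
  forall v, x (l, v) = y (l, v).
Proof.
move=> xy le_yx v.
have /eqP eqs : supp x l == supp y l by rewrite eqEcard suppS.
have /setP/(_ v) := eqs; rewrite !inE.
case xv : (x (l, v)) => [e|]; first by rewrite (sleP _ _ xy _ _ xv).
by case: (y (l, v)).
Qed.

Lemma free_sizeS x y l : sle x y -> (free_size x l <= free_size y l)%N.
Proof.
move=> xy; apply/bigmax_leqP => Y /andP[Yx /forall_inP fr].
apply: (leq_bigmax_cond (F := fun Y : {set T} => #|Y|)).
rewrite /free_in (subset_trans Yx (suppS _ xy)); apply/forall_inP => e eE.
apply/forallP => i; apply: contra (forallP (fr e eE) i) => /subsetP esub.
apply/subsetP => v /esub; rewrite !in_setI => /andP[vY]; rewrite vY !cls_partE.
move/subsetP/(_ _ vY): Yx; rewrite inE.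
by case xv : (x (l, v)) => [f|] // _; rewrite (sleP _ _ xy _ _ xv).
Qed.

Lemma free_in_maxP x l : exists2 Y, free_in x l Y & free_size x l = #|Y|.
Proof.
have f0 : free_in x l set0.
  rewrite /free_in sub0set; apply/forall_inP => e eE; apply/forallP => i.
  by rewrite set0I subset0; apply: contraNneq (E0 l) => <-.
have [|Y fY maxY] := @eq_bigmax_cond _ (free_in x l) (fun Y => #|Y|).
  by apply/card_gt0P; exists set0.
by exists Y; last exact: maxY.
Qed.

(* Every sign whose class contains an edge loses a vertex in passing to an
   edge-free part of the support. *)
Lemma free_size_hit x l : (free_size x l + #|hit x l| <= #|supp x l|)%N.
Proof.
have [Y /andP[Yx /forall_inP fr] ->] := free_in_maxP x l.
rewrite -(cardsID Y (supp x l)) (setIidPr Yx) leq_add2l.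
apply: leq_trans (leq_imset_card (fun v => odflt 0 (x (l, v))) _).
apply/subset_leq_card/subsetP => i; rewrite inE => /exists_inP[e eE ei].
have /subsetPn[v ve] := forallP (fr e eE) i.
move/subsetP/(_ _ ve): ei => vi; rewrite in_setI vi andbT => vY.
move: vi; rewrite cls_partE => /eqP xv.
by apply/imsetP; exists v; rewrite ?xv // !inE vY xv.
Qed.

Lemma free_size_hit0 x l : hit x l = set0 -> free_size x l = #|supp x l|.
Proof.
move=> h0; apply/eqP; rewrite eqn_leq.
have := free_size_hit x l; rewrite h0 cards0 addn0 => -> /=.
apply: (leq_bigmax_cond (F := fun Y : {set T} => #|Y|)).
rewrite /free_in subxx; apply/forall_inP => e eE; apply/forallP => i.
apply/negP => /subset_trans/(_ (subsetIr _ _)) ei.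
have : i \notin hit x l by rewrite h0 inE.
by rewrite inE => /exists_inP; apply; exists e.
Qed.

(** Deleting everything outside an edge-free part leaves a partial coloring to which the defect
    bound applies. *)
Lemma free_size_defect x l : (free_size x l + (q.+1 * C).+1 <= #|T|)%N.
Proof.
have [Y /andP[Yx /forall_inP fr] ->] := free_in_maxP x l.
pose z : {ffun T -> option Z} := [ffun v => if v \in Y then x (l, v) else None].
have zfree : mono_free (E l) z.
  apply/forall_inP => e eE; apply/forallP => i.
  apply: contra (forallP (fr e eE) i) => /subsetP ez.
  apply/subsetP => v /ez; rewrite !inE !ffunE.
  by case: (v \in Y).
rewrite -(cardsC Y) leq_add2l; apply: leq_trans (E_defect zfree) _.
apply/subset_leq_card/subsetP => v; rewrite !inE ffunE.
case: ifP => // vY; move/subsetP/(_ _ vY): Yx; rewrite inE => xv.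
by rewrite (negbTE xv).
Qed.

Lemma level_supp x l : (level x l <= #|supp x l|)%N.
Proof. by rewrite /level; case: ifP => // _; exact: free_size_hit. Qed.

Lemma level_hit0 x l : hit x l = set0 -> level x l = #|supp x l|.
Proof.
rewrite /level => h0; case: ifP => // _.
by rewrite free_size_hit0 // h0 cards0 addn0.
Qed.

Lemma hitT_le x y l : sle x y -> hit x l = setT -> hit y l = setT.
Proof. by move=> /(hitS l) + xT; rewrite xT subTset => /eqP. Qed.

Lemma level_le x y l : sle x y -> (level x l <= level y l)%N.
Proof.
move=> xy; rewrite {2}/level; case: eqP => [_|yT].
  exact: leq_trans (level_supp _ _) (subset_leq_card (suppS _ xy)).
rewrite /level; case: eqP => [/(hitT_le xy)//|_].
by rewrite leq_add ?free_sizeS // subset_leq_card // hitS.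
Qed.

(** Both summands of the level are monotone, so equality of the sums forces equality of the sets of
    signs. If that set is empty or everything, the level is the size of the support, and nested
    vectors with equally large supports agree. *)
Lemma level_eq x y l : sle x y -> level x l = level y l ->
  hit x l = hit y l /\
  (~~ proper_set (hit x l) -> forall v, x (l, v) = y (l, v)).
Proof.
move=> xy; rewrite {2}/level; case: eqP => [yT lev|yT].
  have xeq : forall v, x (l, v) = y (l, v).
    by apply: supp_eq => //; rewrite -lev level_supp.
  split => //; have pxy : part x l = part y l by apply/ffunP => v; rewrite !ffunE.
  by rewrite /hit pxy.
have levy : (free_size y l + #|hit y l|)%N = level y l.
  by rewrite /level; case: eqP.
rewrite levy {1}/level; case: eqP => [/(hitT_le xy)//|xT] lev.
have hxy : hit x l = hit y l.
  apply/eqP; rewrite eqEcard hitS //.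
  by have := free_sizeS l xy; move: lev; rewrite -levy; lia.
split=> //; rewrite /proper_set negb_and !negbK => /orP[/eqP x0|/eqP//].
apply: supp_eq => //; rewrite -!level_hit0 -?hxy //.
by rewrite -lev {1}/level; case: eqP.
Qed.

(** * Ranking by colors once every sign is hit in every hypergraph *)

Definition full x := [forall l, hit x l == setT].

Definition sum_level x := (\sum_l level x l)%N.

Definition selects x i (e : {ffun I -> {set T}}) :=
  [forall l, (e l \in E l) && (e l \subset cls (part x l) i)].

Definition top_color x : nat := \max_(e | [exists i, selects x i e]) c e.

Definition top_signs x :=
  [set i | [exists e, selects x i e && (c e == top_color x :> nat)]].

Lemma full_le x y : sle x y -> full x -> full y.
Proof.
move=> xy /forallP fx; apply/forallP => l; apply/eqP.
exact: (hitT_le xy (eqP (fx l))).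
Qed.

Lemma full_selects x i : full x -> exists e, selects x i e.
Proof.
move=> /forallP fx.
have ex l : exists e, (e \in E l) && (e \subset cls (part x l) i).
  have : i \in hit x l by rewrite (eqP (fx l)) inE.
  by rewrite inE => /exists_inP[e eE ei]; exists e; rewrite eE.
exists [ffun l => xchoose (ex l)]; apply/forallP => l; rewrite ffunE.
exact: (xchooseP (ex l)).
Qed.

Lemma selectsS x y i e : sle x y -> selects x i e -> selects y i e.
Proof.
move=> xy /forallP sx; apply/forallP => l; have /andP[-> ex] := sx l.
exact: subset_trans ex (cls_partS _ _ xy).
Qed.

Lemma top_color_le x y : sle x y -> (top_color x <= top_color y)%N.
Proof.
move=> xy; apply/bigmax_leqP => e /existsP[i sx].
apply: (leq_bigmax_cond (F := fun e => nat_of_ord (c e))).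
by apply/existsP; exists i; exact: selectsS sx.
Qed.

Lemma top_color_lt x : (0 < C)%N -> (top_color x < C)%N.
Proof.
by move=> C_gt0; rewrite -(prednK C_gt0) ltnS; apply/bigmax_leqP => e _;
  rewrite -ltnS prednK.
Qed.

Lemma top_signsS x y : sle x y -> top_color x = top_color y ->
  top_signs x \subset top_signs y.
Proof.
move=> xy mxy; apply/subsetP => i; rewrite !inE -mxy => /existsP[e /andP[sx ce]].
by apply/existsP; exists e; rewrite (selectsS xy sx).
Qed.

(** Classes of distinct signs are disjoint, so a tuple of the top color in every sign would give the
    family excluded by [no_mono]. *)
Lemma top_signsNT x : top_signs x != setT.
Proof.
apply/eqP => sT.
have ex i : exists e, selects x i e && (c e == top_color x :> nat).
  by apply/existsP; have := in_setT i; rewrite -sT inE.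
have eP i := xchooseP (ex i).
apply: (@no_mono (fun i => xchoose (ex i))) => [i l|i j l ij|i j].
- by have /andP[/forallP/(_ l)/andP[]] := eP i.
- have /andP[/forallP/(_ l)/andP[_ ei] _] := eP i.
  have /andP[/forallP/(_ l)/andP[_ ej] _] := eP j.
  apply: disjointWl ei _; apply: disjointWr ej _.
  rewrite -setI_eq0; apply/eqP/setP => v; rewrite in_setI !cls_partE inE.
  by case: eqP => // ->; apply/eqP => -[] /eqP; rewrite (negbTE ij).
- have /andP[_ /eqP ci] := eP i; have /andP[_ /eqP cj] := eP j.
  by apply: ord_inj; exact: etrans ci (esym cj).
Qed.

Lemma top_signs_proper x : full x -> proper_set (top_signs x).
Proof.
move=> fx; rewrite /proper_set top_signsNT andbT.
have [e0 se0] := full_selects 0 fx.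
have [|e /existsP[i sxe] ce] := @eq_bigmax_cond _
    (fun e => [exists i, selects x i e]) (fun e => nat_of_ord (c e)).
  by apply/card_gt0P; exists e0; apply/existsP; exists 0.
apply/set0Pn; exists i; rewrite inE; apply/existsP; exists e.
by rewrite sxe /=; apply/eqP; exact: esym ce.
Qed.

(** If the top color were 0, every tuple in every sign would have color 0, and every sign would be a
    top sign. *)
Lemma top_color_gt0 x : full x -> (0 < top_color x)%N.
Proof.
move=> fx; rewrite lt0n; apply: contra (top_signsNT x) => /eqP m0.
apply/eqP/setP => i; rewrite !inE; have [e se] := full_selects i fx.
apply/existsP; exists e; rewrite se m0 -leqn0 -m0.
apply: (leq_bigmax_cond (F := fun e => nat_of_ord (c e))).
by apply/existsP; exists i.
Qed.

(** * Equivariance under the cyclic shift of signs *)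

Lemma cls_sact k x l i : cls (part (sact k x) l) i = cls (part x l) (i - k).
Proof.
apply/setP => v; rewrite !cls_partE ffunE; case: (x (l, v)) => [e|] //=.
by rewrite !(inj_eq Some_inj) -(inj_eq (addIr (- k))) addrK.
Qed.

Lemma supp_sact k x l : supp (sact k x) l = supp x l.
Proof. by apply/setP => v; rewrite !inE sact_None. Qed.

Lemma hit_sact k x l : hit (sact k x) l = shift k (hit x l).
Proof.
apply/setP => i; rewrite mem_shift !inE; apply: eq_existsb => e.
by rewrite cls_sact.
Qed.

Lemma free_size_sact k x l : free_size (sact k x) l = free_size x l.
Proof.
apply: eq_bigl => Y; rewrite /free_in supp_sact; congr (_ && _).
apply: eq_forallb => e; congr (_ ==> _).
apply/forallP/forallP => h i; last by rewrite cls_sact; exact: h.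
by rewrite -[i](addrK k) -cls_sact; exact: h.
Qed.

Lemma level_sact k x l : level (sact k x) l = level x l.
Proof.
by rewrite /level hit_sact shift_eqT card_shift supp_sact free_size_sact.
Qed.

Lemma full_sact k x : full (sact k x) = full x.
Proof. by apply: eq_forallb => l; rewrite hit_sact shift_eqT. Qed.

Lemma selects_sact k x i e : selects (sact k x) i e = selects x (i - k) e.
Proof. by apply: eq_forallb => l; rewrite cls_sact. Qed.

Lemma top_color_sact k x : top_color (sact k x) = top_color x.
Proof.
apply: eq_bigl => e; apply/existsP/existsP => -[i].
  by rewrite selects_sact => se; exists (i - k).
by move=> se; exists (i + k); rewrite selects_sact addrK.
Qed.

Lemma top_signs_sact k x : top_signs (sact k x) = shift k (top_signs x).
Proof.
apply/setP => i; rewrite mem_shift !inE top_color_sact.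
by apply: eq_existsb => e; rewrite selects_sact.
Qed.

(** Fallback when no hit set is proper. The coordinate picked depends only on the support, hence is
    the same for all translates. *)
Definition first_sign x : Z :=
  if [pick v | x v != None] is Some v then odflt 0 (x v) else 0.

Lemma first_sign_sact k x : snz x -> first_sign (sact k x) = first_sign x + k.
Proof.
move=> /existsP[v0 xv0]; rewrite /first_sign.
under eq_pick do rewrite sact_None.
case: pickP => [v|/(_ v0)]; last by rewrite xv0.
by rewrite ffunE; case: (x v).
Qed.

(* The largest rank available when some sign set is not full; the higher ranks
   take C - 1 colors times q.+1 sizes, since the top color is never color 0. *)
Definition low_max := (#|I| * #|T| - (q.+1 * C.-1).+1)%N.

(** The high ranks encode a pair lexicographically: [#|top_signs x|] lies in 1, ..., [q.+1], so
    different top colors occupy disjoint blocks of length [q.+1]. *)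
Definition rank x :=
  if full x then (low_max + (top_color x).-1 * q.+1 + #|top_signs x|)%N
  else sum_level x.

Definition sign x : Z :=
  if full x then barycenter (top_signs x)
  else if [pick l | proper_set (hit x l)] is Some l then barycenter (hit x l)
  else first_sign x.

(** * Bounds and monotonicity for rank and sign *)

Lemma C_gt0 : (0 < C)%N.
Proof. exact: leq_ltn_trans (leq0n _) (ltn_ord (c [ffun=> set0])). Qed.

(** The subtraction in [low_max] does not truncate, since the defect bound makes [#|T|] exceed
    [q.+1 * C]. *)
Lemma low_maxE : (low_max + (q.+1 * C.-1).+1 = #|I| * #|T|)%N.
Proof.
have /card_gt0P[l _] := I_gt0.
rewrite subnK //; apply: leq_trans (leq_pmull _ I_gt0).
apply: leq_trans (free_size_defect [ffun=> None] l).
by apply: leq_trans (leq_addl _ _); rewrite ltnS leq_mul2l leq_pred orbT.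
Qed.

(** A hypergraph missing some sign loses [q.+1 * C + 1] to the defect and regains at most [q.+1]
    from its set of signs; every other one contributes at most [#|T|]. *)
Lemma sum_level_low x : ~~ full x -> (sum_level x <= low_max)%N.
Proof.
move=> /forallPn[l0 xl0].
have lev0 : (level x l0 + (q.+1 * C).+1 <= #|T| + q.+1)%N.
  rewrite /level (negbTE xl0) addnAC; apply: leq_add (free_size_defect _ _) _.
  have := proper_card (etrans (properT (hit x l0)) xl0).
  by rewrite cardsT card_ord.
have rest : (\sum_(l | l != l0) level x l <= #|I|.-1 * #|T|)%N.
  rewrite -(cardC1 l0) -sum_nat_const; apply: leq_sum => l _.
  exact: leq_trans (level_supp _ _) (max_card _).
have := low_maxE; rewrite /sum_level (bigD1 l0) //=.
move: rest lev0; rewrite -(prednK C_gt0) -(prednK I_gt0) mulnS mulSn /=.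
by lia.
Qed.

Lemma level_gt0 x l v : x (l, v) != None -> (0 < level x l)%N.
Proof.
move=> xlv.
have sgt0 : (0 < #|supp x l|)%N by apply/card_gt0P; exists v; rewrite inE.
case: (posnP #|hit x l|) => [/cards0_eq h0|hgt0]; first by rewrite level_hit0.
by rewrite /level; case: ifP => // _; rewrite addn_gt0 hgt0 orbT.
Qed.

Lemma rank_full x : full x -> (low_max < rank x < #|I| * #|T|)%N.
Proof.
move=> fx; rewrite /rank fx -low_maxE.
have /proper_set_card/andP[Sgt0 Slt] := top_signs_proper fx.
have Mgt0 := top_color_gt0 fx; have Mlt := top_color_lt x C_gt0.
have : ((top_color x).-1.+1 * q.+1 <= q.+1 * C.-1)%N.
  by rewrite mulnC leq_mul2l; lia.
rewrite mulSn; move: (_ * q.+1)%N (q.+1 * _)%N low_max #|_| Sgt0 Slt.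
by move=> a b m n *; lia.
Qed.

Lemma rank_bounds x : snz x -> (0 < rank x < #|I| * #|T|)%N.
Proof.
move=> /existsP[[l v] xlv]; case: (boolP (full x)) => [/rank_full|fx].
  by case/andP=> /(leq_ltn_trans (leq0n _)) -> ->.
apply/andP; split; rewrite /rank (negbTE fx).
  by rewrite /sum_level (bigD1 l) //= addn_gt0 (level_gt0 xlv).
apply: leq_ltn_trans (sum_level_low fx) _.
by rewrite -low_maxE addnS ltnS leq_addr.
Qed.

Lemma rank_full_le x y : sle x y -> full x -> full y -> (rank x <= rank y)%N /\
  (rank x = rank y -> top_signs x = top_signs y).
Proof.
move=> xy fx fy; rewrite /rank fx fy.
have /proper_set_card/andP[Sx0 Sx] := top_signs_proper fx.
have /proper_set_card/andP[Sy0 Sy] := top_signs_proper fy.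
have Mx0 := top_color_gt0 fx; have := top_color_le xy.
rewrite leq_eqVlt => /orP[/eqP mxy|mxy].
  have sub := top_signsS xy mxy.
  rewrite mxy leq_add2l subset_leq_card //; split=> // /addnI card_xy.
  by apply/eqP; rewrite eqEcard sub card_xy leqnn.
have : ((top_color x).-1.+1 * q.+1 <= (top_color y).-1 * q.+1)%N.
  by rewrite leq_mul2r; lia.
rewrite mulSn => lt_xy; suff : (low_max + (top_color x).-1 * q.+1 + #|top_signs x|
    < low_max + (top_color y).-1 * q.+1 + #|top_signs y|)%N.
  by move=> lt; split=> [|eq_xy]; [exact: ltnW|rewrite eq_xy ltnn in lt].
move: lt_xy; move: (_ * q.+1)%N (_ * q.+1)%N low_max #|_| Sx #|_| Sy0.
by move=> a b m n *; lia.
Qed.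

Lemma rank_le x y : sle x y -> (rank x <= rank y)%N.
Proof.
move=> xy; case: (boolP (full x)) => fx.
  by have [] := rank_full_le xy fx (full_le xy fx).
case: (boolP (full y)) => fy.
  have /andP[/ltnW + _] := rank_full fy; apply: leq_trans.
  by rewrite /rank (negbTE fx) sum_level_low.
by rewrite /rank (negbTE fx) (negbTE fy); apply: leq_sum => l _; exact: level_le.
Qed.

(** Full and non-full ranks are separated by [low_max]. Among non-full vectors, equal sums of
    monotone levels agree termwise, so the hit sets agree; if none is proper, the vectors themselves
    coincide. *)
Lemma sign_eq x y : sle x y -> rank x = rank y -> sign x = sign y.
Proof.
move=> xy rxy; rewrite /sign; case: (boolP (full x)) => fx.
  have fy := full_le xy fx; rewrite fy.
  by have [_ /(_ rxy) ->] := rank_full_le xy fx fy.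
case: (boolP (full y)) => fy.
  have /andP[+ _] := rank_full fy.
  by rewrite -rxy ltnNge /rank (negbTE fx) sum_level_low.
have lev l : level x l = level y l.
  have /eq_leqif := leqif_sum (fun l (_ : xpredT l) => leqif_eq (level_le l xy)).
  move: rxy; rewrite /rank (negbTE fx) (negbTE fy) /sum_level => -> /esym.
  by rewrite eqxx => /forallP/(_ l)/eqP.
have hxy l : hit x l = hit y l by have [] := level_eq xy (lev l).
have <- : [pick l | proper_set (hit x l)] = [pick l | proper_set (hit y l)].
  by apply: eq_pick => l; rewrite hxy.
case: pickP => [l _|no_proper]; first by rewrite hxy.
congr first_sign; apply/ffunP => -[l v].
by have [_ ->] := level_eq xy (lev l); rewrite ?no_proper.
Qed.

Lemma rank_sact k x : rank (sact k x) = rank x.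
Proof.
rewrite /rank full_sact top_color_sact top_signs_sact card_shift.
by congr (if _ then _ else _); apply: eq_bigr => l _; exact: level_sact.
Qed.

Lemma sign_sact k x : snz x -> sign (sact k x) = sign x + k.
Proof.
move=> nx; rewrite /sign full_sact top_signs_sact.
case: ifP => fx; first by rewrite barycenter_shift // top_signs_proper.
under eq_pick do rewrite hit_sact proper_shift.
case: pickP => [l pl|_]; last exact: first_sign_sact.
by rewrite hit_sact barycenter_shift.
Qed.

Lemma prime_case_absurd : False.
Proof.
apply: (@monotone_Zp_tucker q (I * T)%type sign rank).
- by rewrite card_prod -low_maxE addnS.
- by move=> x /rank_bounds; rewrite card_prod.
- exact: sign_sact.
- by move=> k x _; exact: rank_sact.
- by move=> x y _; exact: rank_le.
- by move=> x y _; exact: sign_eq.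
Qed.

End PrimeCase.

Lemma kneser_product_bound_prime p : prime p -> kneser_product_bound p.
Proof.
case: p => [|[|q]] // prime_p I T E C c I_gt0 E0 E_defect.
apply: contrapT => no_e.
apply: (@prime_case_absurd q I T E C c) => // e eE disj mono.
by apply: no_e; exists e.
Qed.

(** * Composite r and the theorem *)

Section Composite.
Variables (a b : nat).
Hypotheses (a_gt0 : (0 < a)%N) (b_gt0 : (0 < b)%N).
Hypotheses (bound_a : kneser_product_bound a) (bound_b : kneser_product_bound b).

Definition sub_edges (T : finType) (E : {set {set T}}) (A : {set T}) :=
  [set e in E | e \subset A].

(* Below a tuple of hard sets, the bound for [a] yields a monochromatic family,
   whose color then colors the tuple. *)
Definition hard_sets (T : finType) (E : {set {set T}}) (C : nat) :=
  [set A | `[< defect_ge 'I_a (sub_edges E A) (a.-1 * C).+1 >]].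

Lemma card_code : #|{: 'I_b * 'I_a}| = (a * b)%N.
Proof. by rewrite card_prod !card_ord mulnC. Qed.

Definition code (ij : 'I_b * 'I_a) : 'I_(a * b) := cast_ord card_code (enum_rank ij).
Definition decode (k : 'I_(a * b)) := enum_val (cast_ord (esym card_code) k).

Lemma codeK : cancel code decode.
Proof. by move=> ij; rewrite /code /decode cast_ordK enum_rankK. Qed.

Lemma decode_inj : injective decode.
Proof. by move=> k k' /enum_val_inj/cast_ord_inj. Qed.

(** No class of [y] is hard, so each has a partial coloring by [a] colors with at most (a - 1) C
    deletions. Refining [y] by these uses [a * b] colors, and the deletions add up through ab - 1 =
    (b - 1) + b (a - 1). *)
Lemma hard_sets_defect (T : finType) (E : {set {set T}}) (C : nat) :
  defect_ge 'I_(a * b) E ((a * b).-1 * C).+1 ->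
  defect_ge 'I_b (hard_sets E C) (b.-1 * C).+1.
Proof.
move=> E_defect y y_free.
have /choice[z zP] i : exists z : {ffun T -> option 'I_a},
    mono_free (sub_edges E (cls y i)) z /\
    (#|[set v | z v == None]| <= a.-1 * C)%N.
  have [hard|] := boolP (cls y i \in hard_sets E C).
    by have /forallP/(_ i) := forall_inP y_free _ hard; rewrite subxx.
  rewrite inE => /asboolPn /existsNP[z /not_implyP[z_free /negP]].
  by rewrite -leqNgt => z_le; exists z.
pose w : {ffun T -> option 'I_(a * b)} :=
  [ffun v => obind (fun i => omap (fun j => code (i, j)) (z i v)) (y v)].
have wE v k : w v = Some k ->
    y v = Some (decode k).1 /\ z (decode k).1 v = Some (decode k).2.
  rewrite ffunE; case: (y v) => [i|] //=; case zv : (z i v) => [j|] //= -[<-].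
  by rewrite codeK.
have w_free : mono_free E w.
  apply/forall_inP => e eE; apply/forallP => k; apply/negP => /subsetP ek.
  have [/forall_inP zf _] := zP (decode k).1.
  have e_sub : e \in sub_edges E (cls y (decode k).1).
    rewrite inE eE; apply/subsetP => v /ek; rewrite !inE => /eqP/wE[-> _].
    exact: eqxx.
  move/forallP/(_ (decode k).2)/negP: (zf e e_sub); apply.
  by apply/subsetP => v /ek; rewrite !inE => /eqP/wE[_ ->].
have := E_defect w w_free.
have w_sub : [set v | w v == None] \subset
    [set v | y v == None] :|: \bigcup_i [set v | z i v == None].
  apply/subsetP => v; rewrite !inE ffunE; case: (y v) => [i|] //=.
  by case zv : (z i v) => [j|] //= _; apply/bigcupP; exists i; rewrite ?inE ?zv.
have U_le : (#|\bigcup_i [set v | z i v == None]| <= b * (a.-1 * C))%N.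
  rewrite -[b in (b * _)%N]card_ord -sum_nat_const.
  elim/big_rec2: _ => [|i A n _ le_A]; first by rewrite cards0.
  apply: leq_trans (leq_card_setU _ _) _.
  by rewrite leq_add //; have [] := zP i.
move=> w_gt; have := leq_trans w_gt (subset_leq_card w_sub).
move=> /leq_trans/(_ (leq_card_setU _ _))/leq_trans/(_ (leq_add (leqnn _) U_le)).
have -> : ((a * b).-1 * C = b.-1 * C + b * (a.-1 * C))%N.
  by case: (a) a_gt0 (b) b_gt0 => // a' _ [] // b' _ /=; nia.
by rewrite -addSn leq_add2r.
Qed.

(** The bound for [b] gives disjoint tuples of hard sets of one color, and below each the bound for
    [a] gives disjoint tuples of edges of that color. *)
Lemma kneser_product_bound_mul : kneser_product_bound (a * b).
Proof.
move=> I T E C c I_gt0 E0 E_defect.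
pose good (A : {ffun I -> {set T}}) (e : 'I_a -> {ffun I -> {set T}}) :=
  [/\ forall i l, e i l \in sub_edges (E l) (A l),
      forall i j l, i != j -> [disjoint e i l & e j l]
    & forall i j, c (e i) = c (e j)].
have /choice[sel selP] (A : {ffun I -> {set T}}) : exists e,
    (forall l, A l \in hard_sets (E l) C) -> good A e.
  have [hardA|] := pselect (forall l, A l \in hard_sets (E l) C); last first.
    (* An arbitrary value: only tuples of hard sets are used later. *)
    by move=> nhard; exists (fun=> [ffun=> set0]).
  have [|l|e eP] := @bound_a I T (fun l => sub_edges (E l) (A l)) C c I_gt0.
  - by move=> l; rewrite inE negb_and E0.
  - by have := hardA l; rewrite inE => /asboolP.
  - by exists e.
pose i0 : 'I_a := Ordinal a_gt0.
have [l|l|A [A_hard A_disj A_col]] :=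
    @bound_b I T (fun l => hard_sets (E l) C) C (fun A => c (sel A i0)) I_gt0.
(* The empty set is not hard: it contains no edge, so even a total constant coloring is admissible,
   with no deletion. *)
- rewrite inE; apply/asboolPn => hard0.
  have /hard0 : mono_free (sub_edges (E l) set0) [ffun=> Some i0].
    apply/forall_inP => e; rewrite inE subset0 => /andP[eE /eqP e0].
    by rewrite e0 (negbTE (E0 l)) in eE.
  by rewrite (_ : [set v | _] = set0) ?cards0 //; apply/setP => v; rewrite !inE ffunE.
- exact: hard_sets_defect.
have good_sel i : good (A i) (sel (A i)) by apply: selP => l; exact: A_hard.
exists (fun k => sel (A (decode k).1) (decode k).2); split.
- move=> k l; have [sub _ _] := good_sel (decode k).1.
  by have := sub (decode k).2 l; rewrite inE => /andP[].
- move=> k k' l kk'.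
  have [sub disj _] := good_sel (decode k).1.
  have [sub' _ _] := good_sel (decode k').1.
  have [e1|n1] := eqVneq (decode k).1 (decode k').1.
    rewrite -e1; apply: disj; apply: contraNneq kk' => e2.
    by apply/eqP/decode_inj; rewrite [LHS]surjective_pairing e1 e2 -surjective_pairing.
  have := sub (decode k).2 l; have := sub' (decode k').2 l.
  rewrite !inE => /andP[_ s'] /andP[_ s].
  by apply: disjointWl s _; apply: disjointWr s' _; exact: A_disj.
- move=> k k'.
  have [_ _ col] := good_sel (decode k).1.
  have [_ _ col'] := good_sel (decode k').1.
  by rewrite (col _ i0) (col' _ i0); exact: A_col.
Qed.

End Composite.

Lemma kneser_product_bound_all r : (2 <= r)%N -> kneser_product_bound r.
Proof.
elim/ltn_ind: r => r IH r2.
have [pr|npr] := boolP (prime r); first exact: kneser_product_bound_prime.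
have p_pr : prime (pdiv r) by exact: pdiv_prime.
have p2 := prime_gt1 p_pr.
have rE : (pdiv r * (r %/ pdiv r))%N = r by rewrite mulnC divnK ?pdiv_dvd.
have m2 : (1 < r %/ pdiv r)%N.
  rewrite ltn_divRL ?pdiv_dvd // mul1n ltn_neqAle pdiv_leq ?andbT; last by lia.
  by apply: contraNneq npr => <-.
have m_gt0 := ltnW m2; have p_gt0 := ltnW p2.
rewrite -rE; apply: kneser_product_bound_mul => //.
  exact: kneser_product_bound_prime.
by apply: IH => //; apply: ltn_Pdiv => //; lia.
Qed.

Lemma cd_le_card (H : hypergraph) (r : nat) (Y : {set vertex H}) :
  colorable (induced (~: Y)) r -> (cd H r <= (#|Y|%:R)%:E)%E.
Proof.
move=> col; by apply: bigmin_le_cond; rewrite chi_le.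
Qed.

(** * Transfer to the chromatic number of the product *)

Section Assembly.
Variables (r t : nat) (H : 'I_t -> hypergraph).
Hypothesis r_ge2 : (2 <= r)%N.
Hypothesis t_gt0 : (1 <= t)%N.
Hypothesis H0 : forall l, set0 \notin edges (H l).

(** The disjoint union supplies the common vertex type over which [kneser_product_bound] is
    stated. *)
Definition total_vertex : finType := {l : 'I_t & vertex (H l)}.

Definition inj_vertex l (v : vertex (H l)) : total_vertex := Tagged (vertex \o H) v.

Lemma inj_vertex_inj l : injective (@inj_vertex l).
Proof. by move=> v w /eqP; rewrite /inj_vertex eq_Tagged => /eqP. Qed.

Definition inj_edges l : {set {set total_vertex}} :=
  (fun e : {set vertex (H l)} => (@inj_vertex l) @: e) @: edges (H l).

Lemma inj_edges0 l : set0 \notin inj_edges l.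
Proof.
apply/imsetP => -[e eE] /esym/eqP; rewrite imset_eq0 => /eqP e0.
by have := H0 l; rewrite -e0 eE.
Qed.

(** A partial coloring of the union without monochromatic edge restricts to a proper coloring of the
    undeleted vertices of [H l], so at least [cd (H l) r] of its vertices are deleted. *)
Lemma inj_edges_defect l (d : nat) : (((d%:R : rat)%R)%:E < cd (H l) r)%E ->
  defect_ge 'I_r (inj_edges l) d.+1.
Proof.
move=> d_lt x x_free.
pose Y := [set v : vertex (H l) | x (inj_vertex v) == None].
suff col : colorable (induced (~: Y)) r.
  have := lt_le_trans d_lt (cd_le_card col); rewrite lte_fin ltr_nat => d_ltY.
  apply: leq_trans d_ltY _; rewrite -(card_imset _ (@inj_vertex_inj l)).
  by apply/subset_leq_card/subsetP => _ /imsetP[v + ->]; rewrite !inE.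
pose i0 : 'I_r := Ordinal (ltnW r_ge2).
(* The default [i0] is never taken, as vertices outside [Y] carry a color. *)
apply/existsP; exists [ffun v => odflt i0 (x (inj_vertex (val v)))].
apply/forall_inP => e; rewrite inE => eE; apply/negP => /forall_inP mono.
have /set0Pn[v ve] : e != set0.
  by apply: contraTneq eE => ->; rewrite imset0 H0.
have xE (w : induced_vertex (~: Y)) :
    x (inj_vertex (val w)) = Some (odflt i0 (x (inj_vertex (val w)))).
  by have := valP w; rewrite !inE; case: (x _).
have := forall_inP x_free _ (imset_f _ eE).
move=> /forallP/(_ (odflt i0 (x (inj_vertex (val v))))) /negP; apply.
apply/subsetP => _ /imsetP[_ /imsetP[w we ->] ->]; rewrite inE xE.
by have /forall_inP/(_ _ we) := mono v ve; rewrite !ffunE eq_sym => /eqP ->.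
Qed.

Lemma cprod_defect (C : nat) : colorable (cprod (fun l => kneser r (H l))) C ->
  exists l, (cd (H l) r <= ((((r.-1 * C)%N)%:R : rat)%R)%:E)%E.
Proof.
case/existsP=> col /forall_inP col_proper.
apply: contrapT => /forallNP no_l.
have defect l : defect_ge 'I_r (inj_edges l) (r.-1 * C).+1.
  by apply: inj_edges_defect; rewrite ltNge; apply/negP/no_l.
(* A hypergraph without edges has defect at most 0, against [no_l]. The edge found serves as the
   default in [back]. *)
have w0 l : exists e : kneser_vertex (H l), predT e.
  have [no_edge|[e eE]] := set_0Vmem (edges (H l)); last by exists (exist _ e eE).
  case: (no_l l); apply: le_trans (@cd_le_card _ _ set0 _) _; last first.
    by rewrite cards0 lee_fin ler_nat.
  apply/existsP; exists [ffun=> Ordinal (ltnW r_ge2)].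
  by apply/forall_inP => e; rewrite inE no_edge inE.
pose back (u : {ffun 'I_t -> {set total_vertex}}) :
    cprod_vertex (fun l => kneser r (H l)) :=
  finfun (fun l : 'I_t =>
    insubd (xchoose (w0 l)) ((@inj_vertex l) @^-1: u l) : vertex (kneser r (H l))).
have backE (u : {ffun 'I_t -> {set total_vertex}}) l :
    u l \in inj_edges l -> val (back u l) = (@inj_vertex l) @^-1: u l.
  case/imsetP=> e eE ue; rewrite ffunE val_insubd.
  have -> : (@inj_vertex l) @^-1: u l = e.
    by apply/setP => v; rewrite inE ue mem_imset //; exact: inj_vertex_inj.
  by rewrite eE.
have [||l|e [eE disj mono]] := @kneser_product_bound_all r r_ge2 'I_t total_vertex
    inj_edges C (fun u => col (back u)).
- by rewrite card_ord.
- exact: inj_edges0.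
- exact: defect.
(* Disjointness holds coordinate by coordinate under a common index [i], so every projection of the
   family is a Kneser edge. *)
have F_edge : [set back (e i) | i : 'I_r] \in edges (cprod (fun l => kneser r (H l))).
  rewrite inE; apply/forallP => l; rewrite inE.
  pose g := [ffun i => back (e i) l].
  have gE i : val (g i) = (@inj_vertex l) @^-1: e i l.
    by rewrite (ffunE (fun i => back (e i) l)) backE.
  apply/existsP; exists g; apply/andP; split.
    by apply/eqP; rewrite -imset_comp; apply: eq_imset => i; rewrite /= [in RHS]ffunE.
  apply/forallP => i; apply/forallP => j; apply/implyP => ij.
  rewrite !gE -setI_eq0 -preimsetI.
  by have := disj i j l ij; rewrite -setI_eq0 => /eqP ->; rewrite preimset0.
apply/negP: (col_proper _ F_edge); rewrite negbK.
apply/forall_inP => _ /imsetP[i _ ->]; apply/forall_inP => _ /imsetP[j _ ->].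
by apply/eqP; exact: mono.
Qed.

End Assembly.

Theorem theorem1 (r t : nat) (H : 'I_t -> hypergraph)
    (hr : (2 <= r)%N) (ht : (1 <= t)%N)
    (hH : forall l : 'I_t, set0 \notin edges (H l)) :
  ((((r%:R - 1)^-1)%R : rat)%:E *
     \big[Order.min/+oo]_(l < t) cd (H l) r
   <= chi (cprod (fun l : 'I_t => kneser r (H l))))%E.
Proof.
rewrite /chi; case: pselect => [ex|_]; last exact: leey.
case: ex_minnP => C C_col _.
have [l cd_le] := cprod_defect hr ht hH C_col.
have r1_gt0 : (0 < r%:R - 1 :> rat)%R by rewrite subr_gt0 ltr1n.
rewrite lee_pdivrMl //; apply: le_trans (bigmin_le _ l _) _.
apply: le_trans cd_le _; rewrite -EFinM lee_fin natrM.
by rewrite -subn1 natrB // ltnW.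
Qed.
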